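(* Let $0<r<1$ and let $\underline{T}=(T_1,\dots,T_d)$ be a tuple of invertible operators on a Hilbert space $\mathcal H$. Then $\underline{T}$ is a doubly commuting tuple of operators in $C_{1,r}$ if and only if there exist a tuple $(U_1,\dots,U_d)$ of commuting unitaries and a tuple $(D_1,\dots,D_d)$ of commuting self-adjoint $\mathbb A_r$-contractions on $\mathcal H$ such that $D_iU_j=U_jD_i$ for $1\le i,j\le d$ with $i\ne j$, and $T_j=U_jD_j$ for $1\le j\le d$.
   Context: $C_{1,r}=\{T: T\text{ invertible},\ \|T\|\le1,\ \|rT^{-1}\|\le1\}$. $\mathbb A_r=\{z\in\mathbb C: r<|z|<1\}$. An operator $T$ is an $\mathbb A_r$-contraction if the closed annulus $\overline{\mathbb A}_r$ is a spectral set for $T$, i.e. $\sigma(T)\subseteq\overline{\mathbb A}_r$ and $\|f(T)\|\le\sup_{z\in\overline{\mathbb A}_r}|f(z)|$ for every rational function $f$ with poles off $\overline{\mathbb A}_r$. A tuple is doubly commuting if $T_iT_j=T_jT_i$ for all $i,j$ and $T_iT_j^*=T_j^*T_i$ for $i\ne j$. *)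

(* Defs.v *)
(* complex Hilbert spaces and bounded operators, set up by hand. *)
From HB Require Import structures.
From mathcomp Require Import all_boot all_order all_algebra.
From mathcomp Require Import reals complex.
Set Implicit Arguments. Unset Strict Implicit. Unset Printing Implicit Defensive.
Import Order.TTheory GRing.Theory Num.Theory.
Local Open Scope ring_scope.

Section Hilbert.
Variable R : realType.
Local Notation C := (complex R).
Variable V : lmodType C.
Variable ip : V -> V -> C.

(* norm induced by the inner product *)
Definition hnorm (x : V) : C := sqrtC (ip x x).

(* (V, ip) is a complex Hilbert space: inner product axioms + completeness *)
Definition is_hilbert : Prop :=
  [/\ (forall (a : C) (x y z : V), ip (a *: x + y) z = a * ip x z + ip y z),
      (forall x y : V, ip x y = (ip y x)^*),
      (forall x : V, 0 <= ip x x),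
      (forall x : V, ip x x = 0 -> x = 0) &
      (forall u : nat -> V,
         (forall e : C, 0 < e -> exists N : nat, forall m n : nat,
            (N <= m)%N -> (N <= n)%N -> hnorm (u m - u n) < e) ->
         exists l : V, forall e : C, 0 < e -> exists N : nat, forall n : nat,
            (N <= n)%N -> hnorm (u n - l) < e)].

(* bounded (complex-)linear operator on V *)
Definition is_op (T : V -> V) : Prop :=
  (forall (a : C) (x y : V), T (a *: x + y) = a *: T x + T y) /\
  exists M : C, forall x : V, hnorm (T x) <= M * hnorm x.

(* ||T|| <= c *)
Definition op_le (T : V -> V) (c : C) : Prop :=
  forall x : V, hnorm (T x) <= c * hnorm x.

(* S is the (bounded) inverse of T *)
Definition is_inverse (T S : V -> V) : Prop :=
  is_op S /\ cancel T S /\ cancel S T.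

Definition invertible (T : V -> V) : Prop :=
  is_op T /\ exists S, is_inverse T S.

(* S is the adjoint T^* of T *)
Definition is_adjoint (T S : V -> V) : Prop :=
  forall x y : V, ip (T x) y = ip x (S y).

Definition self_adjoint (T : V -> V) : Prop :=
  is_op T /\ is_adjoint T T.

(* U^* U = U U^* = I *)
Definition unitary (U : V -> V) : Prop :=
  is_op U /\ exists S, is_adjoint U S /\ cancel U S /\ cancel S U.

(* C_{1,r} = { T invertible, ||T|| <= 1, ||r T^{-1}|| <= 1 } *)
Definition C1r (r : R) (T : V -> V) : Prop :=
  is_op T /\ op_le T 1 /\
  exists S, is_inverse T S /\ op_le (fun x => real_complex R r *: S x) 1.

(* spectrum *)
Definition spectrum (T : V -> V) (l : C) : Prop :=
  ~ invertible (fun x => T x - l *: x).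

(* polynomial functional calculus p(T) *)
Definition poly_op (p : {poly C}) (T : V -> V) (x : V) : V :=
  \sum_(i < size p) p`_i *: iter i T x.

(* closed annulus  r <= |z| <= 1 *)
Definition in_cl_annulus (r : R) (z : C) : bool := (real_complex R r <= `|z|) && (`|z| <= 1).

(* the closed annulus is a spectral set for T.  Every rational function with
   poles off the closed annulus is p/q with q nonvanishing on it, and
   f(T) = p(T) q(T)^{-1};  "||f(T)|| <= sup |f|" is stated as
   "||f(T)|| <= M for every upper bound M of |f| on the annulus". *)
Definition Ar_contraction (r : R) (T : V -> V) : Prop :=
  is_op T /\
  (forall l : C, spectrum T l -> in_cl_annulus r l) /\
  (forall p q : {poly C},
     (forall z : C, in_cl_annulus r z -> q.[z] != 0) ->
     forall M : C, (forall z : C, in_cl_annulus r z -> `|p.[z] / q.[z]| <= M) ->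
     forall S : V -> V, is_inverse (poly_op q T) S ->
     op_le (fun x => poly_op p T (S x)) M).

(* doubly commuting tuple *)
Definition doubly_commuting (d : nat) (T : 'I_d -> V -> V) : Prop :=
  (forall i j : 'I_d, T i \o T j = T j \o T i) /\
  (forall i j : 'I_d, i != j ->
     forall S : V -> V, is_adjoint (T j) S -> T i \o S = S \o T i).

End Hilbert.

(* Main.v *)
(* For the direct implication take the polar decomposition T_j = U_j D_j with
   D_j = (T_j^* T_j)^(1/2).  The bounds |T_j| <= 1 and |r T_j^-1| <= 1 say that
   r |x| <= |D_j x| <= |x|, and D_j commutes with every bounded operator that
   commutes with T_j^* T_j, which gives all the commutation relations.

   That the annulus is a spectral set for such a self-adjoint D reduces, for a
   rational function p/q bounded by M, to h(D) >= 0 with h = M^2 q^* q - p^* p.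
   If m is the greatest lower bound of h(D), then h(D) - m is not bounded below;
   factoring h - m over the complex numbers, D - z is not bounded below for some
   root z, and this forces z to be real with r <= |z| <= 1, so m = h(z) >= 0.

   Conversely, the functions z and r/z applied to D_j give |D_j| <= 1 and
   |r D_j^-1| <= 1. *)
Require Import Defs.
From HB Require Import structures.
From mathcomp Require Import all_boot all_order all_algebra.
From mathcomp Require Import boolp classical_sets reals complex ring lra.
Import Order.TTheory GRing.Theory Num.Theory.
Local Open Scope ring_scope.
Local Open Scope complex_scope.
Local Notation Re := complex.Re.
Local Notation Im := complex.Im.
Set Implicit Arguments. Unset Strict Implicit. Unset Printing Implicit Defensive.

(** * The real inner product space underlying the complex Hilbert space *)

Section HilbertSpace.
Variables (R : realType) (V : lmodType R[i]) (ip : V -> V -> R[i]).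
Hypothesis hilb : is_hilbert ip.

(** Passing to the real part keeps every estimate inside the ordered field [R]; [ip_rip] recovers
    the complex form. *)
Definition rip (x y : V) : R := Re (ip x y).
Definition nrm (x : V) : R := Num.sqrt (rip x x).

Lemma ipD x y z : ip (x + y) z = ip x z + ip y z.
Proof. by case: hilb => l _ _ _ _; rewrite -{1}[x]scale1r l mul1r. Qed.

Lemma ip0 z : ip 0 z = 0.
Proof. by apply: (@addrI _ (ip 0 z)); rewrite -ipD !addr0. Qed.

Lemma ipZ a x z : ip (a *: x) z = a * ip x z.
Proof.
by case: hilb => l _ _ _ _; rewrite -[a *: x]addr0 l ip0 addr0.
Qed.

Lemma ipJ x y : ip x y = conjc (ip y x).
Proof. by case: hilb => _ -> _ _ _. Qed.

Lemma ipDr x y z : ip z (x + y) = ip z x + ip z y.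
Proof. by rewrite ipJ ipD rmorphD /= -!ipJ. Qed.

Lemma ipZr a x z : ip z (a *: x) = conjc a * ip z x.
Proof. by rewrite ipJ ipZ rmorphM /= -ipJ. Qed.

Lemma ipNr x z : ip z (- x) = - ip z x.
Proof. by rewrite -scaleN1r ipZr rmorphN1 mulN1r. Qed.

Lemma ipBr x y z : ip z (x - y) = ip z x - ip z y.
Proof. by rewrite ipDr ipNr. Qed.

Lemma ip_self x : ip x x = (rip x x)%:C.
Proof.
case: hilb => _ _ p _ _; rewrite /rip RRe_real //.
by rewrite realE p.
Qed.

Lemma ripC x y : rip x y = rip y x.
Proof. by rewrite /rip ipJ; case: (ip y x). Qed.

Lemma ripD x y z : rip (x + y) z = rip x z + rip y z.
Proof. by rewrite /rip ipD raddfD. Qed.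

Lemma ripZ (a : R) x z : rip (a%:C *: x) z = a * rip x z.
Proof. by rewrite /rip ipZ; case: (ip x z) => u v /=; rewrite mul0r subr0. Qed.

Lemma ripDr x y z : rip z (x + y) = rip z x + rip z y.
Proof. by rewrite ripC ripD !(ripC z). Qed.

Lemma ripZr (a : R) x z : rip z (a%:C *: x) = a * rip z x.
Proof. by rewrite ripC ripZ ripC. Qed.

Lemma ripN x z : rip (- x) z = - rip x z.
Proof. by rewrite -scaleN1r -(rmorphN1 (real_complex R)) ripZ mulN1r. Qed.

Lemma ripNr x z : rip z (- x) = - rip z x.
Proof. by rewrite ripC ripN ripC. Qed.

Lemma rip0 z : rip 0 z = 0.
Proof. by rewrite /rip ip0. Qed.

Definition ripE := (ripD, ripDr, ripN, ripNr, ripZ, ripZr).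

Lemma rip_ge0 x : 0 <= rip x x.
Proof. by case: hilb => _ _ p _ _; have := p x; rewrite ip_self ler0c. Qed.

Lemma rip_eq0 x : rip x x = 0 -> x = 0.
Proof. by case: hilb => _ _ _ n _ h; apply: n; rewrite ip_self h. Qed.

Lemma nrm_ge0 x : 0 <= nrm x. Proof. exact: sqrtr_ge0. Qed.
Lemma nrm_sqr x : nrm x ^+ 2 = rip x x.
Proof. by rewrite sqr_sqrtr // rip_ge0. Qed.
Lemma nrm_eq0 x : nrm x = 0 -> x = 0.
Proof. by move=> h; apply: rip_eq0; rewrite -nrm_sqr h expr0n. Qed.
Lemma nrm0 : nrm 0 = 0. Proof. by rewrite /nrm rip0 sqrtr0. Qed.

Lemma rip_ext x y : (forall z, rip z x = rip z y) -> x = y.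
Proof.
move=> h; apply/eqP; rewrite -subr_eq0; apply/eqP; apply: rip_eq0.
by rewrite ripDr ripNr h subrr.
Qed.

(** The form is conjugate-linear on the right, so [ip x ('i *: y)] is [- 'i * ip x y], whose real
    part is the imaginary part of [ip x y]. *)
Lemma ip_rip x y : ip x y = rip x y +i* rip x ('i *: y).
Proof. by rewrite /rip ipZr; case: (ip x y) => a b /=; rewrite !mul0r !sub0r mulN1r opprK. Qed.

Lemma hnormE x : hnorm ip x = (nrm x)%:C.
Proof.
rewrite /hnorm ip_self -nrm_sqr rmorphXn /= sqrCK // ler0c; exact: nrm_ge0.
Qed.

Lemma nrmZ (a : R[i]) x : nrm (a *: x) = Re `|a| * nrm x.
Proof.
rewrite /nrm; have -> : rip (a *: x) (a *: x) = Re `|a| ^+ 2 * rip x x.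
  rewrite /rip ipZ ipZr ip_self normc_def.
  case: a => u v /=; rewrite sqr_sqrtr ?addr_ge0 ?sqr_ge0 //; ring.
rewrite sqrtrM ?sqr_ge0 // sqrtr_sqr ger0_norm // normc_def; exact: sqrtr_ge0.
Qed.

Lemma nrmZr (a : R) x : nrm (a%:C *: x) = `|a| * nrm x.
Proof. by rewrite nrmZ normc_def /= expr0n addr0 sqrtr_sqr. Qed.

Lemma nrmN x : nrm (- x) = nrm x.
Proof. by rewrite /nrm !ripE opprK. Qed.

Lemma nrmBC x y : nrm (x - y) = nrm (y - x).
Proof. by rewrite -nrmN opprB. Qed.

(** Evaluate the quadratic at its minimiser [t = - b / c]. Besides both Cauchy-Schwarz inequalities,
    this gives the approximate stationarity in [riesz]. *)
Lemma discr_le (a b c : R) :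
  0 <= c -> (forall t, 0 <= a + 2 * t * b + t ^+ 2 * c) -> b ^+ 2 <= a * c.
Proof.
rewrite le_eqVlt => /orP[/eqP<- h|c0 h].
  have [->|b0] := eqVneq b 0; first by rewrite expr0n mulr0.
  (* At this [t] the now affine expression equals -1, so [c = 0] forces [b = 0]. *)
  have := h (- (a + 1) / (2 * b)); rewrite mulr0 addr0.
  have -> : 2 * (- (a + 1) / (2 * b)) * b = - (a + 1) by field; rewrite b0.
  lra.
have := h (- b / c); have -> : a + 2 * (- b / c) * b + (- b / c) ^+ 2 * c = a - b ^+ 2 / c.
  by field; rewrite gt_eqF.
by rewrite subr_ge0 ler_pdivrMr.
Qed.

Lemma CS x y : rip x y ^+ 2 <= rip x x * rip y y.
Proof.
apply: discr_le => [|t]; first exact: rip_ge0.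
have := rip_ge0 (x + t%:C *: y); rewrite !ripE (ripC y x) => h.
by apply: le_trans h _; lra.
Qed.

Lemma rip_le x y : `|rip x y| <= nrm x * nrm y.
Proof.
rewrite -sqrtr_sqr -sqrtrM ?rip_ge0 // ler_wsqrtr //; exact: CS.
Qed.

Lemma nrmD x y : nrm (x + y) <= nrm x + nrm y.
Proof.
rewrite -ler_sqr ?nnegrE ?addr_ge0 ?nrm_ge0 //.
rewrite nrm_sqr !ripE (ripC y x) -!nrm_sqr.
have := rip_le x y; have := ler_norm (rip x y) => h1 h2.
have := le_trans h1 h2; nra.
Qed.

Lemma nrmB x y : nrm (x - y) <= nrm x + nrm y.
Proof. by rewrite -(nrmN y) nrmD. Qed.

Lemma nrm_diff x y : nrm x - nrm y <= nrm (x - y).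
Proof. by rewrite lerBlDr -{1}(subrK y x) nrmD. Qed.

Lemma complete (u : nat -> V) :
  (forall e : R, 0 < e -> exists N : nat, forall m n : nat,
     (N <= m)%N -> (N <= n)%N -> nrm (u m - u n) < e) ->
  exists l : V, forall e : R, 0 < e -> exists N : nat, forall n : nat,
     (N <= n)%N -> nrm (u n - l) < e.
Proof.
move=> h; case: hilb => _ _ _ _ /(_ u)[].
  (* A complex [e] with [0 < e] has zero imaginary part, so real tolerances suffice. *)
  move=> [e e'] /= /[dup] e0; rewrite ltcE /= => /andP[/eqP-> /h[N HN]].
  by exists N => m n mN nN; rewrite hnormE ltcR HN.
move=> l hl; exists l => e e0; case: (hl e%:C); first by rewrite ltcR.
by move=> N HN; exists N => n /HN; rewrite hnormE ltcR.
Qed.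

Lemma lim_unique (x : V) : (forall e : R, 0 < e -> nrm x < e) -> x = 0.
Proof.
move=> h; apply: nrm_eq0; apply/eqP; rewrite eq_le nrm_ge0 andbT leNgt.
by apply/negP => /h; rewrite ltxx.
Qed.

(** * Bounded operators *)

Definition lin (T : V -> V) := forall (a : R[i]) (x y : V), T (a *: x + y) = a *: T x + T y.

Section Linear.
Variables (T : V -> V) (lT : lin T).
Lemma linD x y : T (x + y) = T x + T y.
Proof. by rewrite -{1}[x]scale1r lT scale1r. Qed.
Lemma lin0 : T 0 = 0.
Proof. by apply: (@addrI _ (T 0)); rewrite -linD !addr0. Qed.
Lemma linZ a x : T (a *: x) = a *: T x.
Proof. by rewrite -[a *: x]addr0 lT lin0 addr0. Qed.
Lemma linN x : T (- x) = - T x.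
Proof. by rewrite -scaleN1r linZ scaleN1r. Qed.
Lemma linB x y : T (x - y) = T x - T y.
Proof. by rewrite linD linN. Qed.
End Linear.

(** The complex order makes [M * hnorm ip x] a nonnegative real, hence equal to its own modulus, so
    [M] may be replaced by its modulus. *)
Lemma bounded_real (T : V -> V) (M : R[i]) :
  (forall x, hnorm ip (T x) <= M * hnorm ip x) -> forall x, nrm (T x) <= Re `|M| * nrm x.
Proof.
move=> h x; have := h x; rewrite !hnormE => h1.
have : 0 <= M * (nrm x)%:C by apply: le_trans h1; rewrite ler0c nrm_ge0.
move=> h2; move: h1; rewrite -(ger0_norm h2) normrM (ger0_norm (x := (nrm x)%:C)) ?ler0c ?nrm_ge0 //.
by rewrite normc_def -rmorphM lecR.
Qed.

Lemma op_bounded T : is_op ip T -> exists2 K : R, 0 < K & forall x, nrm (T x) <= K * nrm x.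
Proof.
move=> [_ [M /bounded_real h]]; exists (Re `|M| + 1).
  by rewrite ltr_wpDl // normc_def sqrtr_ge0.
by move=> x; apply: le_trans (h x) _; rewrite ler_wpM2r ?nrm_ge0 // lerDl.
Qed.

Lemma op_intro T (K : R) : lin T -> (forall x, nrm (T x) <= K * nrm x) -> is_op ip T.
Proof.
move=> lT h; split=> //; exists K%:C => x.
by rewrite !hnormE -rmorphM lecR.
Qed.

Lemma op_leP T (c : R) : op_le ip T c%:C <-> forall x, nrm (T x) <= c * nrm x.
Proof.
by split=> h x; have := h x; rewrite !hnormE -rmorphM lecR.
Qed.

Lemma op_comp S T : is_op ip S -> is_op ip T -> is_op ip (S \o T).
Proof.
move=> oS oT; have [K K0 hK] := op_bounded oS; have [L L0 hL] := op_bounded oT.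
apply: (@op_intro _ (K * L)) => [a x y|x] /=; first by rewrite oT.1 oS.1.
by rewrite -mulrA; apply: le_trans (hK _) _; rewrite ler_pM2l.
Qed.

Lemma op_id : is_op ip id.
Proof. by apply: (@op_intro _ 1) => // x; rewrite mul1r. Qed.

Lemma op_add S T : is_op ip S -> is_op ip T -> is_op ip (fun x => S x + T x).
Proof.
move=> oS oT; have [K K0 hK] := op_bounded oS; have [L L0 hL] := op_bounded oT.
apply: (@op_intro _ (K + L)) => [a x y|x].
  by rewrite oT.1 oS.1 scalerDr; rewrite addrACA.
by apply: le_trans (nrmD _ _) _; rewrite mulrDl lerD.
Qed.

Lemma op_scale a T : is_op ip T -> is_op ip (fun x => a *: T x).
Proof.
move=> oT; have [L L0 hL] := op_bounded oT.
apply: (@op_intro _ (Re `|a| * L)) => [b x y|x].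
  by rewrite oT.1 scalerDr !scalerA mulrC.
by rewrite nrmZ -mulrA ler_wpM2l // normc_def sqrtr_ge0.
Qed.

Lemma op_shift T l : is_op ip T -> is_op ip (fun x => T x - l *: x).
Proof.
move=> oT; have := op_add oT (op_scale (- l) op_id).
by congr (is_op _ _); apply/funext => x /=; rewrite scaleNr.
Qed.

(** * Riesz representation, adjoints and inverses *)

Lemma le0_eps (x C : R) : (forall e, 0 < e -> x <= C * e) -> x <= 0.
Proof.
move=> h; rewrite leNgt; apply/negP => x0.
have C0 : 0 < 2 * (`|C| + 1) by rewrite mulr_gt0 // ltr_wpDl.
have := h (x / (2 * (`|C| + 1))); rewrite divr_gt0 // => /(_ isT).
rewrite mulrA ler_pdivlMr //; have := ler_norm C; nra.
Qed.

Lemma invn_small (e : R) : 0 < e -> exists N, forall n, (N <= n)%N -> n.+1%:R^-1 < e.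
Proof.
move=> /ltr_add_invr[N]; rewrite add0r => h; exists N => n Nn.
by apply: le_lt_trans h; rewrite lef_pV2 ?posrE ?ltr0n // ler_nat.
Qed.

(* Riesz representation for the form rip (A x) (A y), by minimising
   |A x|^2 - 2 f x. *)
Lemma riesz (A : V -> V) (f : V -> R) (c M : R) :
  is_op ip A -> 0 < c -> (forall x, c * nrm x <= nrm (A x)) ->
  (forall x y, f (x + y) = f x + f y) ->
  (forall (a : R) x, f (a%:C *: x) = a * f x) ->
  0 <= M -> (forall x, `|f x| <= M * nrm x) ->
  exists z, forall x, f x = rip (A x) (A z).
Proof.
move=> oA c0 hc fD fZ M0 hf.
pose J x := rip (A x) (A x) - 2 * f x.
have AZ a x : A (a%:C *: x) = a%:C *: A x by rewrite (linZ oA.1).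
have AD x y : A (x + y) = A x + A y by rewrite (linD oA.1).
have AB x y : A (x - y) = A x - A y by rewrite (linB oA.1).
(* Since [f x <= (M / c) |A x|], completing the square in [|A x|] bounds [J] below. *)
have Jge x : - (M / c) ^+ 2 <= J x.
  have h1 : f x <= (M / c) * nrm (A x).
    apply: le_trans (ler_norm _) _; apply: le_trans (hf x) _.
    by rewrite -mulrA ler_wpM2l // ler_pdivlMl.
  rewrite /J -nrm_sqr; have := sqr_ge0 (nrm (A x) - M / c); nra.
pose E := range J.
have hE : has_inf E.
  split; first by exists (J 0), 0.
  by exists (- (M / c) ^+ 2) => _ [x _ <-].
pose m := inf E.
have mJ x : m <= J x by apply: ge_inf; [exact: hE.2 | exists x].
have /choice[u hu] (n : nat) : exists x, J x < m + n.+1%:R^-1.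
  have [|_ [x _ <-] hx] := inf_adherent (eps := n.+1%:R^-1) _ hE.
    by rewrite invr_gt0 ltr0n.
  by exists x.
(* Parallelogram law: the right side with [m] replaced by [J] at the midpoint of [x] and [y] is an
   equality. Hence minimising sequences are Cauchy. *)
have par x y : rip (A (x - y)) (A (x - y)) <= 2 * J x + 2 * J y - 4 * m.
  have := mJ ((2^-1)%:C *: (x + y)); rewrite /J.
  rewrite AB AZ AD fZ fD !ripE (ripC (A y) (A x)); lra.
have [l hl] : exists l, forall e, 0 < e -> exists N, forall n, (N <= n)%N -> nrm (u n - l) < e.
  apply: complete => e e0.
  have ce : 0 < (c * e) ^+ 2 / 4 by rewrite divr_gt0 // exprn_gt0 // mulr_gt0.
  have [N HN] := invn_small ce; exists N => p q Np Nq.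
  rewrite -(ltr_pM2l c0); apply: le_lt_trans (hc _) _.
  rewrite -ltr_sqr ?nnegrE ?nrm_ge0 ?(ltW (mulr_gt0 c0 e0)) // nrm_sqr.
  apply: le_lt_trans (par _ _) _.
  move: (hu p) (hu q) (HN p Np) (HN q Nq).
  move: (J _) (J _) (_^-1) (_^-1) ((c * e) ^+ 2) => *; lra.
exists l => v; have [K K0 hK] := op_bounded oA.
(* [J (u n + t v) >= m > J (u n) - 1/(n+1)] is a quadratic inequality in [t]; its discriminant
   bounds the defect in the Euler equation. *)
have dn n : (rip (A (u n)) (A v) - f v) ^+ 2 <= n.+1%:R^-1 * rip (A v) (A v).
  apply: discr_le => [|t]; first exact: rip_ge0.
  have := mJ (u n + t%:C *: v); have := hu n; rewrite /J.
  rewrite AD AZ fD fZ !ripE (ripC (A v) (A (u n))).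
  move: (n.+1%:R^-1) => *; lra.
apply/eqP; rewrite -subr_eq0 -normr_le0.
apply: (@le0_eps _ (2 * nrm (A v))) => e e0.
rewrite -ler_sqr ?nnegrE ?normr_ge0 ?mulr_ge0 ?nrm_ge0 ?(ltW e0) //.
rewrite real_normK ?num_real //.
have [|N1 HN1] := @invn_small (e ^+ 2); first by rewrite exprn_gt0.
have [|N2 HN2] := hl (e / K); first by rewrite divr_gt0.
pose n := maxn N1 N2.
have h1 := HN1 n (leq_maxl _ _); have h2 := HN2 n (leq_maxr _ _).
have h3 : rip (A (u n - l)) (A v) ^+ 2 <= e ^+ 2 * nrm (A v) ^+ 2.
  rewrite -exprMn -ler_sqrt ?sqr_ge0 // !sqrtr_sqr; apply: le_trans (rip_le _ _) _.
  rewrite (ger0_norm (x := e * _)) ?mulr_ge0 ?nrm_ge0 ?(ltW e0) //.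
  rewrite ler_wpM2r ?nrm_ge0 //; apply: le_trans (hK _) _.
  by move: h2; rewrite ltr_pdivlMr // mulrC => /ltW.
have h4 := dn n; have h5 := rip_ge0 (A v).
rewrite -nrm_sqr in h4 h5.
have h6 : n.+1%:R^-1 * nrm (A v) ^+ 2 <= e ^+ 2 * nrm (A v) ^+ 2.
  by rewrite ler_wpM2r // ltW.
move: h3 h4; rewrite AB !ripE (ripC (A v) (A l)).
set a := rip (A (u n)) _; set b := rip (A l) _ => h3 h4.
(* With p = a - f v and s = a - b, the target (s - p)^2 is at most 2 p^2 + 2 s^2, hence at most (2 e
   |A v|)^2. *)
have := sqr_ge0 ((a - f v) + (a - b)); move: h3 (le_trans h4 h6).
move: (f v) (nrm (A v)) => *; lra.
Qed.

(** By [ip_rip] the imaginary part is a real part with ['i *: y] on the right; that ['i] moves to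
    the left argument, where linearity of [T] carries it through. *)
Lemma adjoint_of_rip T S : lin T ->
  (forall x y, rip (T x) y = rip x (S y)) -> is_adjoint ip T S.
Proof.
move=> lT h x y; rewrite !ip_rip h; congr (_ +i* _).
have H z w : rip z ('i *: w) = rip ((- 'i) *: z) w.
  by rewrite /rip ipZ ipZr; congr (Re (_ * _)); apply/eqP; rewrite eq_complex /= oppr0 !eqxx.
by rewrite !H -h (linZ lT).
Qed.

Lemma rip_adjoint T S x y : is_adjoint ip T S -> rip (T x) y = rip x (S y).
Proof. by rewrite /rip => ->. Qed.

(** Riesz with [A = id] represents [x |-> rip (T x) y]. The bound on [S] comes from
    [|S x|^2 = rip (T (S x)) x <= K |S x| |x|]. *)
Lemma adjoint_exists T : is_op ip T -> exists2 S, is_adjoint ip T S & is_op ip S.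
Proof.
move=> oT; have [K K0 hK] := op_bounded oT.
have /choice[S hS] (y : V) : exists z, forall x, rip (T x) y = rip x z.
  apply: (@riesz id (fun x => rip (T x) y) 1 (K * nrm y)) => // [|x|x x'|a x||x].
  - exact: op_id.
  - by rewrite mul1r.
  - by rewrite (linD oT.1) ripD.
  - by rewrite (linZ oT.1) ripZ.
  - by rewrite mulr_ge0 ?nrm_ge0 ?(ltW K0).
  - apply: le_trans (rip_le _ _) _; rewrite mulrAC ler_wpM2r ?nrm_ge0 //.
have aS : is_adjoint ip T S.
  by apply: adjoint_of_rip => //; case: oT.
exists S => //; apply: (@op_intro _ K) => [a x y|x].
  apply: rip_ext => z.
  by rewrite /rip -aS !(ipDr, ipZr) -!aS.
have [->|nx] := eqVneq (nrm (S x)) 0.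
  by rewrite mulr_ge0 ?nrm_ge0 ?(ltW K0).
have n0 : 0 < nrm (S x) by rewrite lt_def nx nrm_ge0.
rewrite -(ler_pM2l n0) -expr2 nrm_sqr /rip -aS.
apply: le_trans (ler_norm _) _; apply: le_trans (rip_le _ _) _.
by rewrite mulrA ler_wpM2r ?nrm_ge0 // mulrC.
Qed.

Lemma adjoint_sym T S : is_adjoint ip T S -> is_adjoint ip S T.
Proof. by move=> h x y; rewrite ipJ -h -ipJ. Qed.

Lemma adjoint_unique T S S' : is_adjoint ip T S -> is_adjoint ip T S' -> S = S'.
Proof.
move=> h h'; apply/funext => x; apply: rip_ext => z.
by rewrite /rip -h -h'.
Qed.

Lemma ip_ext x y : (forall z, ip z x = ip z y) -> x = y.
Proof. by move=> h; apply: rip_ext => z; rewrite /rip h. Qed.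

Definition bounded_below (T : V -> V) := exists2 c : R, 0 < c & forall x, c * nrm x <= nrm (T x).

Lemma bounded_below_eq0 T x : bounded_below T -> T x = 0 -> x = 0.
Proof.
move=> [c c0 h] Tx; apply: nrm_eq0; apply/eqP; rewrite eq_le nrm_ge0 andbT.
by rewrite -(ler_pM2l c0) mulr0; apply: le_trans (h x) _; rewrite Tx nrm0.
Qed.

(** To solve [T z = y], represent [x |-> rip (T x) y] as [rip (T x) (T z)]. Then [S (T z - y) = 0],
    and [S] is injective. *)
Lemma bounded_below_invertible T S : is_op ip T -> is_op ip S ->
  is_adjoint ip T S -> bounded_below T -> bounded_below S ->
  exists T', is_inverse ip T T'.
Proof.
move=> oT oS aS bT bS; have [K K0 hK] := op_bounded oT.
have [c c0 hc] := bT.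
have /choice[T' hT'] (y : V) : exists z, T z = y.
  have [|x|x x'|a x||x|z hz] := @riesz T (fun x => rip (T x) y) c (K * nrm y) oT => //.
  - by rewrite (linD oT.1) ripD.
  - by rewrite (linZ oT.1) ripZ.
  - by rewrite mulr_ge0 ?nrm_ge0 ?(ltW K0).
  - by apply: le_trans (rip_le _ _) _; rewrite mulrAC ler_wpM2r ?nrm_ge0.
  exists z; apply/eqP; rewrite -subr_eq0; apply/eqP.
  apply: (bounded_below_eq0 bS); apply: rip_ext => x.
  by rewrite /rip -aS -/(rip _ _) ripDr ripNr -hz subrr ipJ ip0.
have TK : cancel T T'.
  move=> x; apply/eqP; rewrite -subr_eq0; apply/eqP.
  by apply: (bounded_below_eq0 bT); rewrite (linB oT.1) hT' subrr.
exists T'; split=> //; apply: (@op_intro _ c^-1) => [a x y|x].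
  by rewrite -[in RHS](TK (a *: _ + _)) oT.1 !hT'.
by rewrite mulrC ler_pdivlMr // mulrC -{2}(hT' x).
Qed.
(** * Square roots *)

Lemma psd_CS A x y : lin A -> is_adjoint ip A A -> (forall z, 0 <= rip (A z) z) ->
  rip (A x) y ^+ 2 <= rip (A x) x * rip (A y) y.
Proof.
move=> lA sA pA; apply: discr_le => [|t]; first exact: pA.
have := pA (x + t%:C *: y); rewrite (linD lA) (linZ lA) !ripE.
rewrite (rip_adjoint y x sA) (ripC y) => h; apply: le_trans h _; lra.
Qed.

(** [psd_CS] with [y = A x] gives [|A x|^4 <= rip (A x) x * q |A x|^2]; divide by [|A x|^2]. *)
Lemma psd_sqr_le A q x : lin A -> is_adjoint ip A A -> (forall z, 0 <= rip (A z) z) ->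
  (forall z, rip (A z) z <= q * rip z z) -> 0 <= q ->
  rip (A x) (A x) <= q * rip (A x) x.
Proof.
move=> lA sA pA hq q0; have := rip_ge0 (A x); rewrite le_eqVlt => /orP[/eqP<-|n0].
  by rewrite mulr_ge0.
rewrite -(ler_pM2r n0) -expr2; apply: le_trans (psd_CS x (A x) lA sA pA) _.
by rewrite mulrAC mulrC ler_wpM2r.
Qed.

Lemma psd_nrm_le A q x : lin A -> is_adjoint ip A A -> (forall z, 0 <= rip (A z) z) ->
  (forall z, rip (A z) z <= q * rip z z) -> 0 <= q ->
  nrm (A x) <= q * nrm x.
Proof.
move=> lA sA pA hq q0; rewrite -ler_sqr ?nnegrE ?mulr_ge0 ?nrm_ge0 //.
rewrite exprMn !nrm_sqr; apply: le_trans (psd_sqr_le x lA sA pA hq q0) _.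
by rewrite expr2 -mulrA ler_wpM2l.
Qed.

Definition tends (u : nat -> V) (l : V) :=
  forall e : R, 0 < e -> exists N, forall n, (N <= n)%N -> nrm (u n - l) < e.

Lemma tends_dom (u v : nat -> V) l m (K : R) :
  (forall n, nrm (v n - m) <= K * nrm (u n - l)) -> tends u l -> tends v m.
Proof.
move=> h hu e e0; have K0 : 0 < `|K| + 1 by rewrite ltr_wpDl.
have [|N HN] := hu (e / (`|K| + 1)); first by rewrite divr_gt0.
exists N => n /HN; rewrite ltr_pdivlMr //; apply: le_lt_trans.
apply: le_trans (h n) _; rewrite mulrC ler_wpM2l ?nrm_ge0 //.
by apply: le_trans (ler_norm _) _; rewrite lerDl.
Qed.

Lemma tends_op T u l : is_op ip T -> tends u l -> tends (fun n => T (u n)) (T l).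
Proof.
move=> oT; have [K K0 hK] := op_bounded oT; apply: (@tends_dom _ _ _ _ K) => n.
by rewrite -(linB oT.1).
Qed.

Lemma tendsD u v l m : tends u l -> tends v m -> tends (fun n => u n + v n) (l + m).
Proof.
move=> hu hv e e0; have e2 : 0 < e / 2 by rewrite divr_gt0.
have [[N HN] [M HM]] := (hu _ e2, hv _ e2); exists (maxn N M) => n.
rewrite geq_max => /andP[/HN h1 /HM h2].
by rewrite opprD addrACA; apply: le_lt_trans (nrmD _ _) _; lra.
Qed.

Lemma tends_shift u l : tends u l -> tends (fun n => u n.+1) l.
Proof. by move=> h e /h[N HN]; exists N => n nN; rewrite HN // ltnW. Qed.

Lemma tends_unique u l m : tends u l -> tends u m -> l = m.
Proof.
move=> hl hm; apply/eqP; rewrite -subr_eq0; apply/eqP; apply: lim_unique => e e0.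
have e2 : 0 < e / 2 by rewrite divr_gt0.
have [[N HN] [M HM]] := (hl _ e2, hm _ e2).
have := HN _ (leq_maxl N M); have := HM _ (leq_maxr N M).
set w := u _ => h1 h2.
have -> : l - m = (w - m) - (w - l) by rewrite opprB [RHS]addrC addrA subrK.
by apply: le_lt_trans (nrmB _ _) _; lra.
Qed.

Lemma tends_nrm_le u l (K : R) : tends u l -> (forall n, nrm (u n) <= K) -> nrm l <= K.
Proof.
move=> hu hK; rewrite -subr_le0; apply: (@le0_eps _ 1) => e /hu[N /(_ N (leqnn N)) h].
rewrite mul1r; have := nrm_diff l (u N); rewrite nrmBC.
have := hK N; move: h; lra.
Qed.

(** Bernoulli-type induction: [(1 + n c) (1 - c)^n <= 1], and [(n + 1) c <= 1 + n c] because
    [c <= 1]. *)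
Lemma expr_small (c : R) n : 0 < c -> c <= 1 -> (1 - c) ^+ n <= c^-1 * n.+1%:R^-1.
Proof.
move=> c0 c1; have h : (1 + n%:R * c) * (1 - c) ^+ n <= 1.
  elim: n => [|n IH]; first by rewrite expr0 mul0r addr0 mulr1.
  have q0 : 0 <= (1 - c) ^+ n by rewrite exprn_ge0 // subr_ge0.
  apply: le_trans IH; rewrite exprS mulrA ler_wpM2r // -natr1.
  have := ler0n R n; nra.
have n0 : 0 < n.+1%:R * c by rewrite mulr_gt0 ?ltr0n.
rewrite -invfM -[leRHS]div1r ler_pdivlMr; last by rewrite mulrC.
apply: le_trans h; rewrite mulrC ler_wpM2r ?exprn_ge0 ?subr_ge0 //.
by rewrite -natr1; have := ler0n R n; nra.
Qed.

Section SquareRoot.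
Variables (A : V -> V) (c : R).
Hypotheses (oA : is_op ip A) (sA : is_adjoint ip A A) (c0 : 0 < c) (c1 : c <= 1).
Hypotheses (Age : forall x, c * rip x x <= rip (A x) x) (Ale : forall x, rip (A x) x <= rip x x).

Local Notation q := (1 - c).

(* Visser's iteration: with X = 1 - A, the fixed point of
   Y |-> (X + Y^2) / 2 satisfies (1 - Y)^2 = A. *)
Fixpoint sqrt_iter (n : nat) (x : V) : V :=
  if n is m.+1 then (2^-1)%:C *: ((x - A x) + sqrt_iter m (sqrt_iter m x)) else 0.

Let X x := x - A x.

Let q0 : 0 <= q. Proof. by rewrite subr_ge0. Qed.

Let lX : lin X.
Proof.
by move=> a x y; rewrite /X oA.1 scalerBr opprD addrACA.
Qed.

Let sX : is_adjoint ip X X.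
Proof.
apply: adjoint_of_rip => // x y.
by rewrite /X !ripE (rip_adjoint _ _ sA).
Qed.

(** As quadratic forms [0 <= X <= q], by [Ale] and [Age]. *)
Let X_le x : nrm (X x) <= q * nrm x.
Proof.
apply: psd_nrm_le => // z; rewrite /X !ripE.
  by rewrite subr_ge0.
by have := Age z; lra.
Qed.

Let iter_lin n : lin (sqrt_iter n).
Proof.
elim: n => [|n IH] a x y /=; first by rewrite scaler0 addr0.
have := lX a x y; rewrite /X => ->; rewrite !IH.
rewrite addrACA -scalerDr [LHS]scalerDr; congr (_ + _).
by rewrite !scalerA mulrC.
Qed.

(** The radius [q] is preserved because (q + q^2) / 2 <= q. *)
Let iter_le n x : nrm (sqrt_iter n x) <= q * nrm x.
Proof.
elim: n x => [|n IH] x /=; first by rewrite nrm0 mulr_ge0 // nrm_ge0.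
rewrite nrmZr ger0_norm ?invr_ge0 //.
have h1 := nrmD (X x) (sqrt_iter n (sqrt_iter n x)).
have h2 := X_le x; have h3 := IH (sqrt_iter n x); have h4 := IH x.
have h5 : q * nrm (sqrt_iter n x) <= nrm (sqrt_iter n x).
  by rewrite ler_piMl ?nrm_ge0 // lerBlDr lerDl ltW.
rewrite ler_pdivrMl //; apply: le_trans h1 _; lra.
Qed.

Let iter_sym n : is_adjoint ip (sqrt_iter n) (sqrt_iter n).
Proof.
apply: adjoint_of_rip => //; elim: n => [|n IH] x y /=; first by rewrite rip0 ripC rip0.
by rewrite ripZ ripZr ripD ripDr (rip_adjoint _ _ sX) !IH.
Qed.

(** Each iterate is a polynomial in [A]. This is the source of the commutation property of the
    square root. *)
Let iter_comm n C : lin C -> C \o A = A \o C -> forall x, C (sqrt_iter n x) = sqrt_iter n (C x).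
Proof.
move=> lC CA; elim: n => [|n IH] x /=; first exact: lin0.
have -> : A (C x) = C (A x) by rewrite -[RHS]/((C \o A) x) CA.
by rewrite linZ // linD // linB // !IH.
Qed.

Let iter_comm2 m n x : sqrt_iter m (sqrt_iter n x) = sqrt_iter n (sqrt_iter m x).
Proof.
apply: iter_comm => //; apply/funext => z /=; apply/esym; apply: iter_comm => //.
exact: oA.1.
Qed.

(** Consecutive iterates commute, so Z^2 - Y^2 = Z (Z - Y) + Y (Z - Y). Both factors have norm at
    most [q], and the half in the recursion leaves one factor [q] per step. *)
Let iter_step n x : nrm (sqrt_iter n.+1 x - sqrt_iter n x) <= q ^+ n * nrm x.
Proof.
elim: n x => [|n IH] x.
  rewrite subr0 expr0 mul1r; apply: le_trans (iter_le 1 x) _.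
  by rewrite ler_piMl ?nrm_ge0 // lerBlDr lerDl ltW.
set Y := sqrt_iter n in IH *; set Z := sqrt_iter n.+1 in IH *.
have -> : sqrt_iter n.+2 x - Z x = (2^-1)%:C *: ((X x + Z (Z x)) - (X x + Y (Y x))).
  by rewrite scalerBr.
have -> : (X x + Z (Z x)) - (X x + Y (Y x)) = Z (Z x - Y x) + Y (Z x - Y x).
  rewrite [Z (_ - _)](linB (iter_lin n.+1)) [Y (_ - _)](linB (iter_lin n)).
  rewrite -/Y -/Z (iter_comm2 n n.+1 x : Y (Z x) = Z (Y x)).
  by rewrite opprD addrACA subrr add0r addrA subrK.
rewrite nrmZr ger0_norm ?invr_ge0 // ler_pdivrMl //.
apply: le_trans (nrmD _ _) _; apply: le_trans (lerD (iter_le _ _) (iter_le _ _)) _.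
have := ler_wpM2l q0 (IH x); rewrite exprS; lra.
Qed.

(** Telescoping [iter_step]: the geometric sum has ratio [q], and 1 - q = c. *)
Let iter_dist n k x : nrm (sqrt_iter (n + k) x - sqrt_iter n x) <= (q ^+ n - q ^+ (n + k)) / c * nrm x.
Proof.
elim: k => [|k IH]; first by rewrite addn0 !subrr !mul0r nrm0.
rewrite addnS -[sqrt_iter _.+1 x](subrK (sqrt_iter (n + k) x)) -addrA.
apply: le_trans (nrmD _ _) _; apply: le_trans (lerD (iter_step _ _) IH) _.
rewrite -mulrDl ler_wpM2r ?nrm_ge0 // exprS.
move: (q ^+ n) (q ^+ (n + k)) => a b.
rewrite [leLHS](_ : _ = (a - (1 - c) * b) / c) //.
by field; rewrite gt_eqF.
Qed.

Let iter_cvg x : exists l, tends (sqrt_iter ^~ x) l.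
Proof.
apply: complete => e e0.
(* One factor [c] pays for [iter_dist], the other for [expr_small]; the half is for comparing two
   indices with [N], and [nrm x + 1] avoids division by zero. *)
have e1 : 0 < e * c ^+ 2 / (nrm x + 1) / 2.
  by rewrite !divr_gt0 ?ltr_wpDl ?nrm_ge0 // mulr_gt0 // exprn_gt0.
have [N HN] := invn_small e1.
have key n : (N <= n)%N -> nrm (sqrt_iter n x - sqrt_iter N x) < e / 2.
  move=> Nn; rewrite -(subnKC Nn); apply: le_lt_trans (iter_dist _ _ _) _.
  have := expr_small N c0 c1; rewrite ler_pdivlMl // => h1.
  move: (HN N (leqnn N)); rewrite -mulrA -invfM ltr_pdivlMr; last first.
    by rewrite mulr_gt0 // ltr_wpDl ?nrm_ge0.
  have : 0 <= N.+1%:R^-1 :> R by rewrite invr_ge0 ler0n.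
  have : 0 <= q ^+ (N + (n - N)) by rewrite exprn_ge0.
  move: h1 (nrm_ge0 x); move: (nrm x) (q ^+ N) (q ^+ (N + _)) (N.+1%:R^-1) => w p p' d.
  move=> h1 w0 p0 d0 h2; rewrite mulrAC ltr_pdivrMr // -(ltr_pM2l c0).
  have := ler_wpM2r w0 h1; have := mulr_ge0 (mulr_ge0 (ltW c0) p0) w0; lra.
exists N => m n Nm Nn.
have -> : sqrt_iter m x - sqrt_iter n x = (sqrt_iter m x - sqrt_iter N x) - (sqrt_iter n x - sqrt_iter N x).
  by rewrite opprB addrA subrK.
by apply: le_lt_trans (nrmB _ _) _; have := key m Nm; have := key n Nn; lra.
Qed.

(** The strong limit [Y] of the iterates satisfies 2 Y = X + Y^2, so B = 1 - Y has B^2 = 1 - X = A.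
    Symmetry and commutation pass to the limit. *)
Lemma sqrt_exists : exists B, [/\ is_op ip B, is_adjoint ip B B, B \o B = A &
  forall C, is_op ip C -> C \o A = A \o C -> C \o B = B \o C].
Proof.
have [Y hY] := choice iter_cvg.
have Ylin : lin Y.
  move=> a x y; apply: (tends_unique (hY _)).
  have -> : sqrt_iter ^~ (a *: x + y) = fun n => a *: sqrt_iter n x + sqrt_iter n y.
    by apply/funext => n; rewrite iter_lin.
  apply: tendsD => //; apply: (tends_op (T := fun z => a *: z)) => //.
  exact: (op_scale a op_id).
have Yle x : nrm (Y x) <= q * nrm x by apply: tends_nrm_le (hY x) _ => n.
have Yop : is_op ip Y by apply: (@op_intro _ q).
have Ysym : is_adjoint ip Y Y.
  apply: adjoint_of_rip => // x y; apply/eqP; rewrite -subr_eq0 -normr_le0.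
  apply: (@le0_eps _ (nrm y + nrm x)) => e e0.
  have [N1 HN1] := hY x e e0; have [N2 HN2] := hY y e e0.
  have := HN1 _ (leq_maxl N1 N2); have := HN2 _ (leq_maxr N1 N2).
  set n := maxn _ _ => h2 h1.
  have -> : rip (Y x) y - rip x (Y y) =
    rip x (sqrt_iter n y - Y y) - rip (sqrt_iter n x - Y x) y.
    by rewrite !ripE (rip_adjoint x y (iter_sym n)); ring.
  apply: le_trans (ler_normB _ _) _; apply: le_trans (lerD (rip_le _ _) (rip_le _ _)) _.
  have := nrm_ge0 x; have := nrm_ge0 y; nra.
have YY x : Y x = (2^-1)%:C *: (X x + Y (Y x)).
  apply: (tends_unique (tends_shift (hY x))) => /=.
  apply: (tends_op (T := fun z => (2^-1)%:C *: z)); first exact: (op_scale _ op_id).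
  have hX : tends (fun=> X x) (X x) by move=> e e0; exists 0 => n _; rewrite subrr nrm0.
  apply: tendsD hX _.
  (* Both occurrences of the iterate vary with [n]: split off [sqrt_iter n (Y x)], and the rest
     vanishes by the uniform bound [iter_le]. *)
  have h1 : tends (fun n => sqrt_iter n (sqrt_iter n x - Y x)) 0.
    apply: (@tends_dom (sqrt_iter ^~ x) _ (Y x) 0 q) => // n.
    by rewrite subr0 iter_le.
  have := tendsD h1 (hY (Y x)); rewrite add0r; congr (tends _ _).
  by apply/funext => n; rewrite (linB (iter_lin n)) subrK.
have YC C : is_op ip C -> C \o A = A \o C -> forall x, C (Y x) = Y (C x).
  move=> oC CA x; apply: (tends_unique (tends_op oC (hY x))).
  have -> : (fun n => C (sqrt_iter n x)) = sqrt_iter ^~ (C x).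
    by apply/funext => n; rewrite iter_comm //; case: oC.
  exact: hY.
exists (fun x => x - Y x); split.
- have := op_add op_id (op_scale (-1) Yop); congr (is_op _ _).
  by apply/funext => x /=; rewrite scaleN1r.
- apply: adjoint_of_rip => [a x y|x y].
    by rewrite Ylin scalerBr opprD addrACA.
  by rewrite !ripE (rip_adjoint _ _ Ysym).
- apply/funext => x /=; rewrite (linB Ylin).
  have : Y x + Y x = X x + Y (Y x).
    rewrite {1 2}YY -scalerDl -rmorphD /= -[RHS]scale1r; congr (_ *: _).
    by rewrite -div1r -splitr.
  move=> h; have -> : x - Y x - (Y x - Y (Y x)) = x - (Y x + Y x) + Y (Y x).
    rewrite opprB opprD !addrA; exact: addrAC.
  by rewrite h opprD opprB addrA subrK addrC subrK.
- move=> C oC CA; apply/funext => x /=; rewrite -YC // (linB oC.1) // YC.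
Qed.

End SquareRoot.

(** * Polynomials in an operator *)

Section Polynomials.
Variable T : V -> V.
Hypothesis oT : is_op ip T.

Lemma poly_op_wide (p : {poly R[i]}) n x : (size p <= n)%N ->
  poly_op p T x = \sum_(i < n) p`_i *: iter i T x.
Proof.
move=> pn; rewrite /poly_op (big_ord_widen n (fun i => p`_i *: iter i T x) pn).
rewrite big_mkcond; apply: eq_bigr => i _; case: ltnP => // hi.
by rewrite nth_default // scale0r.
Qed.

Lemma poly_opD (p q : {poly R[i]}) x : poly_op (p + q) T x = poly_op p T x + poly_op q T x.
Proof.
pose n := maxn (size p) (size q).
rewrite (@poly_op_wide _ n) ?size_polyD // (@poly_op_wide p n) ?leq_maxl //.
rewrite (@poly_op_wide q n) ?leq_maxr // -big_split /=.
by apply: eq_bigr => i _; rewrite coefD scalerDl.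
Qed.

Lemma poly_opZ a (p : {poly R[i]}) x : poly_op (a *: p) T x = a *: poly_op p T x.
Proof.
rewrite (@poly_op_wide _ (size p)) ?size_scale_leq // scaler_sumr.
by apply: eq_bigr => i _; rewrite coefZ scalerA.
Qed.

Lemma poly_opC a x : poly_op a%:P T x = a *: x.
Proof.
by rewrite (@poly_op_wide _ 1) ?size_polyC_leq1 // big_ord1 coefC.
Qed.

Lemma poly_op0 x : poly_op 0 T x = 0.
Proof. by rewrite /poly_op size_poly0 big_ord0. Qed.

Lemma poly_opMX (p : {poly R[i]}) x : poly_op (p * 'X) T x = poly_op p T (T x).
Proof.
rewrite (@poly_op_wide _ (size p).+1); last first.
  by apply: leq_trans (size_polyMleq _ _) _; rewrite size_polyX addn2.
rewrite big_ord_recl coefMX scale0r add0r; apply: eq_bigr => i _.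
by rewrite coefMX /= -iterS iterSr.
Qed.

Lemma poly_opXsubC z x : poly_op ('X - z%:P) T x = T x - z *: x.
Proof.
rewrite poly_opD -polyCN poly_opC scaleNr -['X]mul1r -polyC1 poly_opMX.
by rewrite poly_opC scale1r.
Qed.

Lemma poly_op_is_op (p : {poly R[i]}) : is_op ip (poly_op p T).
Proof.
elim/poly_ind: p => [|p a IH].
  have := op_scale 0 op_id; congr (is_op _ _); apply/funext => x /=.
  by rewrite scale0r poly_op0.
have := op_add (op_comp IH oT) (op_scale a op_id); congr (is_op _ _).
by apply/funext => x; rewrite poly_opD poly_opMX poly_opC.
Qed.

Lemma poly_op_comm (p : {poly R[i]}) x : T (poly_op p T x) = poly_op p T (T x).
Proof.
elim/poly_ind: p x => [|p a IH] x; first by rewrite !poly_op0 (lin0 oT.1).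
by rewrite !poly_opD !poly_opMX !poly_opC (linD oT.1) (linZ oT.1) IH.
Qed.

Lemma poly_opM (p q : {poly R[i]}) x : poly_op (p * q) T x = poly_op p T (poly_op q T x).
Proof.
elim/poly_ind: p x => [|p a IH] x; first by rewrite mul0r !poly_op0.
rewrite mulrDl mulrAC -mulrA !poly_opD !poly_opMX !poly_opC mul_polyC poly_opZ.
by rewrite mulrA poly_opMX IH poly_op_comm.
Qed.

Lemma poly_op_adjoint (p : {poly R[i]}) : is_adjoint ip T T ->
  is_adjoint ip (poly_op p T) (poly_op (map_poly conjc p) T).
Proof.
move=> sT; elim/poly_ind: p => [|p a IH] x y.
  by rewrite rmorph0 !poly_op0 ip0 ipJ ip0 rmorph0.
rewrite rmorphD rmorphM /= map_polyX map_polyC /=.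
rewrite !poly_opD !poly_opMX !poly_opC ipD ipDr ipZ ipZr conjcK IH sT.
by rewrite poly_op_comm.
Qed.

(** The polynomial splits into linear factors over the complex numbers, and lower bounds multiply
    under composition. *)
Lemma poly_op_bounded_below (p : {poly R[i]}) : p != 0 ->
  (forall z, root p z -> bounded_below (fun x => T x - z *: x)) ->
  bounded_below (poly_op p T).
Proof.
have [rs ->] := closed_field_poly_normal p; set a := lead_coef p => pn0 h.
have a0 : a != 0 by apply: contra_neq pn0 => ->; rewrite scale0r.
have {}h z : z \in rs -> bounded_below (fun x => T x - z *: x).
  by move=> zrs; apply: h; rewrite rootZ // root_prod_XsubC.
have [c c0 hc] : bounded_below (poly_op (\prod_(z <- rs) ('X - z%:P)) T).
  elim: rs {pn0} h => [|z rs IH] h.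
    by exists 1 => // x; rewrite big_nil poly_opC scale1r mul1r.
  have [c c0 hc] : bounded_below (poly_op (\prod_(z <- rs) ('X - z%:P)) T).
    by apply: IH => w wrs; apply: h; rewrite inE wrs orbT.
  have [|b b0 hb] := h z; first by rewrite inE eqxx.
  exists (b * c) => [|x]; first exact: mulr_gt0.
  rewrite big_cons poly_opM poly_opXsubC -mulrA.
  by apply: le_trans (hb _); rewrite ler_pM2l.
exists (Re `|a| * c) => [|x].
  rewrite mulr_gt0 //; move: a0; rewrite -normr_gt0 ltcE => /andP[_]; exact.
by rewrite poly_opZ nrmZ -mulrA ler_wpM2l // normc_def sqrtr_ge0.
Qed.

End Polynomials.

(** * Spectral sets for self-adjoint operators with [r |x| <= |D x| <= |x|] *)

Section AnnulusSelfAdjoint.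
Variables (D : V -> V) (r : R).
Hypotheses (oD : is_op ip D) (sD : is_adjoint ip D D) (r0 : 0 < r) (r1 : r < 1).
Hypotheses (Dge : forall x, r * nrm x <= nrm (D x)) (Dle : forall x, nrm (D x) <= nrm x).

(** For real [z] the triangle inequality suffices. For z = a + i b with [b] nonzero, |(D - z) x|^2 =
    |(D - a) x|^2 + b^2 |x|^2. *)
Lemma shift_bounded_below (z : R[i]) :
  ~~ [&& Im z == 0, r <= `|Re z| & `|Re z| <= 1] ->
  bounded_below (fun x => D x - z *: x).
Proof.
case: z => a b /=; rewrite !negb_and -!ltNge; have [-> /=|b0 _] := eqVneq b 0.
  rewrite -/(a%:C); case/orP => ha.
    exists (r - `|a|) => [|x]; first by rewrite subr_gt0.
    apply: le_trans (nrm_diff _ _); rewrite nrmZr; have := Dge x; lra.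
  exists (`|a| - 1) => [|x]; first by rewrite subr_gt0.
  rewrite nrmBC; apply: le_trans (nrm_diff _ _); rewrite nrmZr; have := Dle x; lra.
exists `|b| => [|x]; first by rewrite normr_gt0.
rewrite -ler_sqr ?nnegrE ?mulr_ge0 ?nrm_ge0 // exprMn real_normK ?num_real // !nrm_sqr.
pose y := D x - a%:C *: x; pose w := b%:C *: ('i *: x).
have -> : D x - (a +i* b) *: x = y - w.
  rewrite /y /w -addrA -opprD scalerA -scalerDl; congr (_ - _ *: _).
  by apply/eqP; rewrite eq_complex /=; apply/andP; split; apply/eqP; ring.
(* The cross term vanishes: D - a is self-adjoint, so [ip y x] is real. *)
have yx : rip y ('i *: x) = 0.
  have : conjc (ip y x) = ip y x.
    by rewrite /y -ipJ ipBr ipZr ipD -sD -scaleN1r !ipZ conjc_real; ring.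
  rewrite /rip ipZr; case: (ip y x) => u v [] /eqP.
  rewrite -subr_eq0 -opprD oppr_eq0 -mulr2n mulrn_eq0 /= => /eqP ->.
  by rewrite /=; ring.
have ww : rip ('i *: x) ('i *: x) = rip x x.
  by rewrite /rip ipZ ipZr; case: (ip x x) => u v /=; ring.
clearbody y; rewrite /w !ripE (ripC ('i *: x) y) yx ww; have := rip_ge0 y; lra.
Qed.

(* The greatest lower bound of h(D) is a value of h at a point of the
   approximate spectrum of D. *)
Lemma poly_op_psd (h : {poly R[i]}) : map_poly conjc h = h ->
  (forall a : R, r <= `|a| -> `|a| <= 1 -> 0 <= Re h.[a%:C]) ->
  forall x, 0 <= rip (poly_op h D x) x.
Proof.
move=> hJ hpos x0; rewrite leNgt; apply/negP => neg.
pose H := poly_op h D.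
have oH : is_op ip H by exact: poly_op_is_op.
have sH : is_adjoint ip H H by have := poly_op_adjoint oD h sD; rewrite hJ.
have n0 : 0 < rip x0 x0.
  rewrite lt_def rip_ge0 andbT; apply: contraTneq neg => /rip_eq0 ->.
  by rewrite -leNgt ripC rip0.
have [K K0 hK] := op_bounded oH.
have absH x : `|rip (H x) x| <= K * rip x x.
  apply: le_trans (rip_le _ _) _; rewrite -nrm_sqr expr2 mulrA.
  by rewrite ler_wpM2r ?nrm_ge0.
pose S : set R := fun a => forall x, a * rip x x <= rip (H x) x.
have hS : has_sup S.
  split; first by exists (- K) => x /=; have := absH x; rewrite ler_norml mulNr => /andP[].
  exists (rip (H x0) x0 / rip x0 x0) => a /= /(_ x0); by rewrite ler_pdivlMr.
pose m := sup S.
have Sm : S m.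
  move=> x; have := rip_ge0 x; rewrite le_eqVlt => /orP[/eqP xx|xx].
    by rewrite -xx mulr0 (@rip_eq0 x) // ripC rip0.
  rewrite -ler_pdivlMr //; apply: ge_sup; first exact: hS.1.
  by move=> a /= /(_ x); rewrite ler_pdivlMr.
have m0 : m < 0 by rewrite -(pmulr_llt0 _ n0); apply: le_lt_trans (Sm x0) neg.
pose g := h - (m%:C)%:P.
have gE x : poly_op g D x = H x - m%:C *: x.
  by rewrite poly_opD // -polyCN poly_opC // scaleNr.
(* Otherwise [h] would be the constant [m < 0], against [hpos] at 1. *)
have g0 : g != 0.
  apply/eqP => /(congr1 (fun p => p.[1])); rewrite !hornerE => /eqP; rewrite subr_eq0 => /eqP h1.
  have := hpos 1; rewrite normr1 lexx ltW // h1 /= leNgt m0 => /(_ isT isT) //.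
(* At a root [z] of [g], [h] takes the value [m < 0]; so [z] is not a real point of the annulus, and
   D - z is bounded below. *)
have [c c0 hc] : bounded_below (poly_op g D).
  apply: poly_op_bounded_below => // z; rewrite /root !hornerE subr_eq0 => /eqP hz.
  apply: shift_bounded_below; apply/negP => /and3P[/eqP z0 zr z1].
  have := hpos (Re z) zr z1; have -> : (Re z)%:C = z by case: z z0 {hz zr z1} => a b /= ->.
  by rewrite hz /= leNgt m0.
have oG := poly_op_is_op oD g.
have Gx x : rip (poly_op g D x) x = rip (H x) x - m * rip x x by rewrite gE !ripE.
(* [g(D)] is positive with form at most [K - m], so [psd_sqr_le] turns its norm lower bound into one
   for its form. This pushes [m] up by [c ^+ 2 / (K - m)], contradicting the supremum. *)
have low x : c ^+ 2 * rip x x <= (K - m) * (rip (H x) x - m * rip x x).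
  rewrite -Gx; apply: le_trans (_ : rip (poly_op g D x) (poly_op g D x) <= _).
    rewrite -!nrm_sqr -exprMn ler_sqr ?nnegrE ?mulr_ge0 ?nrm_ge0 ?(ltW c0) //; exact: hc.
  apply: psd_sqr_le => [||z|z|]; first exact: oG.1.
  - apply: adjoint_of_rip => [|u v]; first exact: oG.1.
    by rewrite !gE !ripE (rip_adjoint _ _ sH).
  - by rewrite Gx subr_ge0; exact: Sm.
  - by rewrite Gx mulrBl; have := absH z; rewrite ler_norml => /andP[_]; lra.
  - by rewrite subr_ge0 ltW // (lt_trans m0).
have Km : 0 < K - m by rewrite subr_gt0 (lt_trans m0).
have : S (m + c ^+ 2 / (K - m)).
  move=> x; have := low x; rewrite -ler_pdivrMl // mulrA (mulrC _^-1) mulrDl.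
  move: (c ^+ 2 / _) => k; lra.
move=> /(ub_le_sup hS.2); rewrite -/m gerDl leNgt divr_gt0 // exprn_gt0 //.
Qed.

Lemma Ar_contraction_self_adjoint : Ar_contraction ip r D.
Proof.
split=> //; split.
  move=> l; apply: contra_notT => hl; split; first exact: op_shift.
  have outside (z : R[i]) : ~~ in_cl_annulus r z ->
      ~~ [&& Im z == 0, r <= `|Re z| & `|Re z| <= 1].
    apply: contra => /and3P[/eqP z0 zr z1]; rewrite /in_cl_annulus normc_def z0.
    by rewrite expr0n addr0 sqrtr_sqr !lecR zr z1.
  (* The adjoint of D - l is D - conj l, and the annulus is symmetric under conjugation. *)
  apply: (@bounded_below_invertible _ (fun x => D x - conjc l *: x)).
  - exact: op_shift.
  - exact: op_shift.
  - move=> x y; rewrite ipBr ipZr conjcK -scaleNr ipD ipZ sD; ring.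
  - exact/shift_bounded_below/outside.
  - apply/shift_bounded_below/outside; move: hl; congr (~~ _).
    by rewrite /in_cl_annulus !normc_def; case: (l) => a b /=; rewrite sqrrN.
move=> p q hq M hM S [oS [SK KS]].
have in1 : in_cl_annulus r 1 by rewrite /in_cl_annulus normr1 lexx andbT lecR ltW.
(* [M] bounds a modulus at the point 1, so it is a nonnegative real. *)
have M0 : 0 <= M by apply: le_trans (hM 1 in1).
have ME : M = (Re M)%:C by rewrite RRe_real // realE M0.
set m := Re M in ME; have m0 : 0 <= m by move: M0; rewrite ME ler0c.
(* Writing x = q(D) y turns the claim into [|p(D) y|^2 <= m^2 |q(D) y|^2]. *)
rewrite ME; apply/op_leP => x; rewrite -{2}(KS x); set y := S x.
rewrite -ler_sqr ?nnegrE ?mulr_ge0 ?nrm_ge0 // exprMn !nrm_sqr -subr_ge0.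
pose bar (s : {poly R[i]}) := map_poly conjc s.
have barK s : bar (bar s) = s.
  by rewrite /bar -map_poly_comp map_poly_id // => z _ /=; rewrite conjcK.
have sqE s : rip (poly_op s D y) (poly_op s D y) = rip (poly_op (bar s * s) D y) y.
  rewrite (rip_adjoint _ _ (poly_op_adjoint oD s sD)) ripC -poly_opM //.
pose h := (m ^+ 2)%:C *: (bar q * q) - bar p * p.
have -> : m ^+ 2 * rip (poly_op q D y) (poly_op q D y) - rip (poly_op p D y) (poly_op p D y)
   = rip (poly_op h D y) y.
  by rewrite !sqE /h poly_opD // -scaleN1r !poly_opZ // scaleN1r !ripE.
apply: poly_op_psd.
  rewrite /h rmorphB /= map_polyZ.
  rewrite !(rmorphM (map_poly conjc)) /= -!/(bar _) !barK oppr0.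
  by congr (_ *: _ - _); rewrite mulrC.
(* At a real point [bar s] takes the conjugate value of [s], so h(a) = m^2 |q(a)|^2 - |p(a)|^2. *)
move=> a ra a1; set z := a%:C.
have zin : in_cl_annulus r z by rewrite /in_cl_annulus normc_def /= expr0n addr0 sqrtr_sqr !lecR ra.
have barE s : (bar s).[z] = conjc s.[z].
  by rewrite -[z in LHS]conjc_real horner_map.
rewrite /h !hornerE !barE; have := hM z zin; have := hq z zin.
move: (q.[z]) (p.[z]) => u v u0.
rewrite normrM normfV ler_pdivrMr ?normr_gt0 // ME !normc_def -rmorphM lecR.
rewrite -ler_sqr ?nnegrE ?mulr_ge0 ?sqrtr_ge0 // exprMn.
rewrite !sqr_sqrtr ?addr_ge0 ?sqr_ge0 //; case: u v {u0} => [u1 u2] [v1 v2] /=; lra.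
Qed.

End AnnulusSelfAdjoint.

(** * Polar decomposition of the tuple *)

Section Polar.
Variables (r : R) (r0 : 0 < r) (r1 : r < 1) (d : nat) (T : 'I_d -> V -> V).

Lemma C1r_bounds S : C1r ip r S ->
  (forall x, nrm (S x) <= nrm x) /\ (forall x, r * nrm x <= nrm (S x)).
Proof.
move=> [_ [Sle [S' [[_ [SK _]] S'le]]]]; split=> x.
  by have /(op_leP _ 1)/(_ x) := Sle; rewrite mul1r.
have /(op_leP _ 1)/(_ (S x)) := S'le.
by rewrite mul1r SK nrmZr gtr0_norm.
Qed.

Lemma unitary_nrm U x : unitary ip U -> nrm (U x) = nrm x.
Proof. by move=> [_ [S [aS [US _]]]]; rewrite /nrm (rip_adjoint _ _ aS) US. Qed.

Lemma comm_inverse (S B B' : V -> V) : cancel B B' -> cancel B' B ->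
  (forall x, S (B x) = B (S x)) -> forall x, S (B' x) = B' (S x).
Proof. by move=> BK KB h x; rewrite -{2}[x]KB h BK. Qed.

Lemma polar_of_doubly_commuting :
  doubly_commuting ip T /\ (forall j, C1r ip r (T j)) ->
  exists (U D : 'I_d -> V -> V),
     (forall j : 'I_d, unitary ip (U j)) /\
     (forall i j : 'I_d, U i \o U j = U j \o U i) /\
     (forall j : 'I_d, self_adjoint ip (D j) /\ Ar_contraction ip r (D j)) /\
     (forall i j : 'I_d, D i \o D j = D j \o D i) /\
     (forall i j : 'I_d, i != j -> D i \o U j = U j \o D i) /\
     (forall j : 'I_d, T j = U j \o D j).
Proof.
move=> [[TT TTs] CT].
have oT j : is_op ip (T j) by case: (CT j).
have /choice[Ts hTs] j : exists S, is_adjoint ip (T j) S /\ is_op ip S.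
  by have [S] := adjoint_exists (oT j); exists S.
have aT j : is_adjoint ip (T j) (Ts j) by case: (hTs j).
have /choice[Ti hTi] j : exists S, is_inverse ip (T j) S.
  by have [_ [_ [S []]]] := CT j; exists S.
have TK j : cancel (T j) (Ti j) by case: (hTi j) => _ [].
have KT j : cancel (Ti j) (T j) by case: (hTi j) => _ [].
have sqT j x : rip ((Ts j \o T j) x) x = rip (T j x) (T j x).
  by rewrite ripC -(rip_adjoint _ _ (aT j)).
have /choice[B hB] j : exists B, [/\ is_op ip B, is_adjoint ip B B, B \o B = Ts j \o T j &
    forall C, is_op ip C -> C \o (Ts j \o T j) = (Ts j \o T j) \o C -> C \o B = B \o C].
  have [Tle Tge] := C1r_bounds (CT j).
  (* The form of [Ts j \o T j] is [|T j x|^2], which lies between [r^2 |x|^2] and [|x|^2]. *)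
  apply: (@sqrt_exists _ (r ^+ 2)).
  - exact: op_comp (hTs j).2 (oT j).
  - by move=> x y; rewrite /= (adjoint_sym (aT j)) aT.
  - by rewrite exprn_gt0.
  - by rewrite exprn_ile1 ?ltW.
  - move=> x; rewrite sqT -!nrm_sqr -exprMn ler_sqr ?nnegrE ?mulr_ge0 ?nrm_ge0 ?(ltW r0) //.
  - by move=> x; rewrite sqT -!nrm_sqr ler_sqr ?nnegrE ?nrm_ge0.
have oB j : is_op ip (B j) by case: (hB j).
have sB j : is_adjoint ip (B j) (B j) by case: (hB j).
have BB j x : B j (B j x) = Ts j (T j x) by case: (hB j) => _ _ /(congr1 (fun f => f x)).
have nB j x : nrm (B j x) = nrm (T j x).
  by rewrite /nrm (rip_adjoint _ _ (sB j)) BB ripC sqT.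
have bB j : bounded_below (B j).
  by exists r => // x; rewrite nB; case: (C1r_bounds (CT j)).
have /choice[Bi hBi] j : exists S, is_inverse ip (B j) S.
  exact: bounded_below_invertible (oB j) (oB j) (sB j) (bB j) (bB j).
have BK j : cancel (B j) (Bi j) by case: (hBi j) => _ [].
have KB j : cancel (Bi j) (B j) by case: (hBi j) => _ [].
have tt i j x : T i (T j x) = T j (T i x) := congr1 (@^~ x) (TT i j).
have tts i j x : i != j -> T i (Ts j x) = Ts j (T i x).
  by move=> ij; have := congr1 (@^~ x) (TTs i j ij (Ts j) (aT j)).
(* Double commutation makes [T i] commute with [Ts j \o T j], hence with its square root. Taking
   adjoints gives the same for [Ts i], and then [B j] commutes with [Ts i \o T i] and with [B i]. *)
have tb i j x : i != j -> T i (B j x) = B j (T i x).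
  move=> ij; have [_ _ _ /(_ (T i) (oT i)) h] := hB j.
  suff /h /(congr1 (@^~ x)) : T i \o (Ts j \o T j) = (Ts j \o T j) \o T i by [].
  by apply/funext => z /=; rewrite tts // tt.
have tsb i j x : i != j -> Ts i (B j x) = B j (Ts i x).
  by move=> ij; apply: ip_ext => z; rewrite -aT -!sB -aT tb.
have bb i j x : B i (B j x) = B j (B i x).
  have [->//|ij] := eqVneq i j.
  have [_ _ _ /(_ (B j) (oB j)) h] := hB i.
  suff /h /(congr1 (@^~ x)) : B j \o (Ts i \o T i) = (Ts i \o T i) \o B j by [].
  by apply/funext => z /=; rewrite tb // tsb.
have tbi i j x : i != j -> T i (Bi j x) = Bi j (T i x).
  by move=> ij; apply: (comm_inverse (BK j) (KB j)) => z; exact: tb.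
have bbi i j x : B i (Bi j x) = Bi j (B i x).
  by apply: (comm_inverse (BK j) (KB j)) => z; exact: bb.
have bibi i j x : Bi i (Bi j x) = Bi j (Bi i x).
  by apply: (comm_inverse (BK j) (KB j)) => z; rewrite bbi.
exists (fun j => T j \o Bi j), B; split; [|split; [|split; [|split; [|split]]]].
- move=> j; split; first by apply: op_comp (oT j) _; case: (hBi j).
  (* The inverse of [T j \o Bi j] is also its adjoint: write y = T (Ti y), replace [Ts j \o T j] by
     [B j \o B j], and cancel one [B j] against [Bi j]. *)
  exists (B j \o Ti j); split; last by split=> x /=; rewrite ?TK ?BK ?KB ?KT.
  by move=> x y /=; rewrite -{1}(KT j y) aT -BB -sB KB.
- move=> i j; have [->//|ij] := eqVneq i j; apply/funext => x /=.
  by rewrite -tbi 1?eq_sym // tt bibi tbi.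
- move=> j; split; first by split.
  have [Tle Tge] := C1r_bounds (CT j).
  by apply: Ar_contraction_self_adjoint => // x; rewrite nB.
- by move=> i j; apply/funext => x /=; rewrite bb.
- by move=> i j ij; apply/funext => x /=; rewrite -tb 1?eq_sym // bbi.
- by move=> j; apply/funext => x /=; rewrite BK.
Qed.

Lemma doubly_commuting_of_polar (U D : 'I_d -> V -> V) :
  (forall j, invertible ip (T j)) ->
  (forall j, unitary ip (U j)) -> (forall i j, U i \o U j = U j \o U i) ->
  (forall j, self_adjoint ip (D j) /\ Ar_contraction ip r (D j)) ->
  (forall i j, D i \o D j = D j \o D i) ->
  (forall i j, i != j -> D i \o U j = U j \o D i) ->
  (forall j, T j = U j \o D j) ->
  doubly_commuting ip T /\ (forall j, C1r ip r (T j)).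
Proof.
move=> hT uU UU hD DD DU TE.
have /choice[W hW] j : exists S, is_adjoint ip (U j) S /\ cancel (U j) S /\ cancel S (U j).
  by case: (uU j).
have aU j : is_adjoint ip (U j) (W j) by case: (hW j).
have UK j : cancel (U j) (W j) by case: (hW j) => _ [].
have KU j : cancel (W j) (U j) by case: (hW j) => _ [].
have uu i j x : U i (U j x) = U j (U i x) := congr1 (@^~ x) (UU i j).
have dd i j x : D i (D j x) = D j (D i x) := congr1 (@^~ x) (DD i j).
have du i j x : i != j -> D i (U j x) = U j (D i x).
  by move=> ij; have := congr1 (@^~ x) (DU i j ij).
have te j x : T j x = U j (D j x) by rewrite TE.
have uw i j x : U i (W j x) = W j (U i x).
  by apply: (comm_inverse (UK j) (KU j)) => z; exact: uu.
have dw i j x : i != j -> D i (W j x) = W j (D i x).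
  by move=> ij; apply: (comm_inverse (UK j) (KU j)) => z; exact: du.
have sD j : is_adjoint ip (D j) (D j) by case: (hD j) => [[]].
have oD j : is_op ip (D j) by case: (hD j) => [[]].
split; first split.
- move=> i j; have [->//|ij] := eqVneq i j; apply/funext => x /=.
  by rewrite !te du // dd uu -du 1?eq_sym.
- move=> i j ij S aS.
  (* The adjoint of [U j \o D j]; its two factors are moved past [U i] and [D i] separately. *)
  have -> : S = D j \o W j.
    by apply: adjoint_unique aS _ => x y; rewrite te aU sD.
  apply/funext => x /=; rewrite !te -uw -dw // dd.
  by rewrite du 1?eq_sym.
move=> j; have [_ [_ [_ spec]]] := hD j; have [oT [S [oS [TS ST]]]] := hT j.
have zn0 z : in_cl_annulus r z -> z != 0.
  by move=> /andP[rz _]; rewrite -normr_gt0; apply: lt_le_trans rz; rewrite ltcR.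
(* Thus [S \o U j] is the inverse of [D j]. *)
have SE x : D j (S (U j x)) = x by apply: (can_inj (UK j)); rewrite -te ST.
have polyX x : poly_op 'X (D j) x = D j x.
  by rewrite -['X]subr0 -polyC0 poly_opXsubC // scale0r subr0.
split=> //; split.
  (* The spectral set property for the function z, bounded by 1 on the annulus. *)
  have /(op_leP _ 1) h : op_le ip (fun x => poly_op 'X (D j) (id x)) 1.
    apply: (spec 'X 1 _ 1 _ id) => [z _|z /andP[_ z1]|]; first by rewrite hornerC oner_eq0.
      by rewrite hornerX hornerC divr1.
    by split; [exact: op_id | split=> x; rewrite -polyC1 poly_opC // scale1r].
  by apply/(op_leP _ 1) => x; rewrite te unitary_nrm // -polyX; exact: h.
exists S; split=> //.
(* The function r / z is also bounded by 1, because [r <= |z|] there. *)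
have /(op_leP _ 1) h : op_le ip (fun x => poly_op (r%:C)%:P (D j) ((S \o U j) x)) 1.
  apply: (spec (r%:C)%:P 'X _ 1 _ (S \o U j)) => [z /zn0|z zin|]; first by rewrite hornerX.
    rewrite hornerX hornerC normrM normfV ler_pdivrMr ?normr_gt0 ?zn0 // mul1r.
    by case/andP: zin => rz _; rewrite ger0_norm // ler0c ltW.
  split; first by apply: op_comp => //; case: (uU j).
  split=> x /=; rewrite polyX ?SE //.
  by rewrite -te TS.
(* [S x] is [S \o U j] at [W j x], and [W j] preserves the norm. *)
apply/(op_leP _ 1) => x; have := h (W j x).
by rewrite poly_opC //= -(unitary_nrm (W j x) (uU j)) KU.
Qed.

End Polar.

End HilbertSpace.

Theorem theorem3p9 (R : realType) (V : lmodType (complex R))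
  (ip : V -> V -> complex R) (Hhil : is_hilbert ip)
  (r : R) (hr0 : 0 < r) (hr1 : r < 1)
  (d : nat) (T : 'I_d -> V -> V)
  (hT : forall j : 'I_d, invertible ip (T j)) :
  (doubly_commuting ip T /\ (forall j : 'I_d, C1r ip r (T j))) <->
  (exists (U D : 'I_d -> V -> V),
     (forall j : 'I_d, unitary ip (U j)) /\
     (forall i j : 'I_d, U i \o U j = U j \o U i) /\
     (forall j : 'I_d, self_adjoint ip (D j) /\ Ar_contraction ip r (D j)) /\
     (forall i j : 'I_d, D i \o D j = D j \o D i) /\
     (forall i j : 'I_d, i != j -> D i \o U j = U j \o D i) /\
     (forall j : 'I_d, T j = U j \o D j)).
Proof.
split; first exact: polar_of_doubly_commuting.
move=> [U [D [uU [UU [hD [DD [DU TE]]]]]]].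
exact: (@doubly_commuting_of_polar _ _ _ Hhil _ hr0 _ _ U D).
Qed.
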